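(* Let $P$ be the uniform distribution on the square region $J=[0,1]\times[0,1]$ with vertices $(0,0),(1,0),(1,1),(0,1)$. Assume that every optimal set of five-means for $P$ contains the center $(\frac12,\frac12)$ of the square, and that its other four points are all at the same distance from the center and either lie on the two lines $x_1=\frac12$ and $x_2=\frac12$ (two on each) or lie on the two diagonals of the square (two on each). Then there is a unique optimal set of five-means for $P$; with coordinates given as decimal approximations (each within $10^{-6}$) it is $\{(0.5,0.5),\,(0.778937,0.778937),\,(0.221063,0.778937),\,(0.221063,0.221063),\,(0.778937,0.221063)\}$, and the quantization error is $V_5(P)=0.0352697$ (decimal approximation, i.e. $|V_5(P)-0.0352697|<10^{-7}$).
   Context: The uniform distribution on $J$ is the Borel probability measure with density $1$ on $J$ and $0$ elsewhere with respect to Lebesgue measure. For a Borel probability measure $P$ on $\mathbb R^d$ and $n\ge1$, the $n$th quantization error is $V_n(P)=\inf\{\int \min_{a\in\alpha}\|x-a\|^2\,dP(x):\alpha\subset\mathbb R^d,\ \mathrm{card}(\alpha)\le n\}$, where $\|\cdot\|$ is the Euclidean norm. A set $\alpha$ with $\mathrm{card}(\alpha)\le n$ attaining the infimum is called an optimal set of $n$-means; for absolutely continuous $P$ it has exactly $n$ elements. *)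

(* Defs.v *)
From HB Require Import structures.
From mathcomp Require Import all_boot all_order all_algebra finmap.
From mathcomp Require Import all_classical all_reals all_analysis.

Set Implicit Arguments.
Unset Strict Implicit.
Unset Printing Implicit Defensive.

Import Order.TTheory GRing.Theory Num.Theory.
Import numFieldNormedType.Exports.

Local Open Scope classical_set_scope.
Local Open Scope ring_scope.

(* The sigma-algebra is the product of the Borel sigma-algebras of the two
   factors, i.e. the Borel sigma-algebra of the plane. *)
Notation plane R := (measurableTypeR R * measurableTypeR R)%type.

Section Quantization.
Context {R : realType}.
Implicit Types (x a : plane R) (J : set (plane R)) (P : probability (plane R) R)
  (n : nat) (A : {fset plane R}).

Definition lebesgue2 := (@lebesgue_measure R \x @lebesgue_measure R)%E.

(* The norm that the library puts on a product is the max norm, hence the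
   explicit Euclidean norm. *)
Definition enorm x : R := Num.sqrt (x.1 ^+ 2 + x.2 ^+ 2).

Definition uniform_distribution J P : Prop :=
  forall B, measurable B -> P B = (\int[lebesgue2]_(x in B) (\1_J x)%:E)%E.

(* Over the empty set the minimum is +oo, so the empty set never competes in
   the infimum below. *)
Definition distortion P A : \bar R :=
  (\int[P]_x \big[mine/+oo]_(a <- A) (enorm (x - a) ^+ 2)%:E)%E.

Definition quantization_error P n : \bar R :=
  ereal_inf [set distortion P A | A in [set A | (#|` A| <= n)%N]].

Definition optimal_means P n A : Prop :=
  (#|` A| <= n)%N /\ distortion P A = quantization_error P n.

Definition unit_square : set (plane R) :=
  [set x | 0 <= x.1 <= 1 /\ 0 <= x.2 <= 1].

Definition center : plane R := (2^-1, 2^-1).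

Definition two_on_each A (l1 l2 : pred (plane R)) : Prop :=
  [/\ forall a, a \in A -> l1 a || l2 a,
      #|` [fset a in A | l1 a]%fset| = 2%N
    & #|` [fset a in A | l2 a]%fset| = 2%N].

Definition centered_cross A : Prop :=
  center \in A /\
  let B := (A `\ center)%fset in
  [/\ #|` B| = 4%N,
      exists r : R, forall a, a \in B -> enorm (a - center) = r
    & two_on_each B (fun a => a.1 == 2^-1) (fun a => a.2 == 2^-1)
      \/ two_on_each B (fun a => a.2 == a.1) (fun a => a.2 == 1 - a.1)].

Definition close_coords (e : R) a b : Prop :=
  `|a.1 - b.1| <= e /\ `|a.2 - b.2| <= e.

End Quantization.

(* Main.v *)
Require Import Defs.
From mathcomp Require Import all_boot all_order all_algebra finmap.
From mathcomp Require Import all_classical all_reals all_analysis.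
From mathcomp Require Import measurable_realfun ring lra.

Set Implicit Arguments.
Unset Strict Implicit.
Unset Printing Implicit Defensive.

Import Order.TTheory GRing.Theory Num.Theory.
Import numFieldNormedType.Exports.

Local Open Scope classical_set_scope.
Local Open Scope ring_scope.

(* An optimal set exists: replacing the points of a competitor by their
   projections onto the square does not increase the distortion, and the
   distortion is a Lipschitz function of five points of the square, hence
   attains its minimum by compactness.  By hypothesis such a set is a centered
   cross.  If its points lie on the lines x_1 = 1/2 and x_2 = 1/2, then with
   u = |x_1 - 1/2| and v = |x_2 - 1/2| the distortion is at least
   E[min(u, v)^2] = 1/24.  Otherwise the four outer points are
   (1/2 +- t, 1/2 +- t), the cost at x is u^2 + v^2 - 2t (u + v - t)_+, and for
   t <= 1/2 its integral is D(t) = 1/6 - t + 2t^2 - 4t^4/3, while for t >= 1/2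
   the distortion is at least D(1/2) = 1/12.  If s is the root of
   1 - 4s + 16s^3/3 near 0.2789373, then
   D(t) - D(s) = (t - s)^2 (2 - 4(t^2 + 2ts + 3s^2)/3), so s is the unique
   minimizer; there D(s) = 1/6 - 3s/4 + s^2 < 1/24. *)

(** * The uniform distribution on the square *)

Section IntegralOverSquare.
Context {R : realType}.
Implicit Types (P : probability (plane R) R) (f : plane R -> \bar R).
Local Notation mu := (@lebesgue_measure R).

Lemma unit_squareE : @unit_square R = `[0, 1] `*` `[0, 1].
Proof.
by apply/seteqP; split => -[x y]; rewrite /unit_square /= !in_itv.
Qed.

Lemma measurable_unit_square : measurable (@unit_square R).
Proof. by rewrite unit_squareE; apply: measurableX. Qed.

Lemma uniform_square_null P : uniform_distribution unit_square P ->
  P (~` unit_square) = 0%E.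
Proof.
move=> hP; have mJ := measurable_unit_square.
rewrite hP; last exact: measurableC.
apply: integral0_eq => x /= xJ.
by rewrite indicE memNset.
Qed.

Lemma ge0_integral_restrict_square P f : uniform_distribution unit_square P ->
  measurable_fun [set: plane R] f -> (forall x, 0 <= f x)%E ->
  (\int[P]_x f x = \int[P]_(x in unit_square) f x)%E.
Proof.
move=> hP mf f0; have mJ := measurable_unit_square.
rewrite (@ge0_negligible_integral _ _ _ P setT (~` unit_square))//.
- by rewrite setTD setCK.
- exact: measurableC.
- exact: uniform_square_null.
Qed.

Lemma ge0_integral_uniform_square P f : uniform_distribution unit_square P ->
  measurable_fun [set: plane R] f -> (forall x, 0 <= f x)%E ->
  (\int[P]_x f x =
   \int[mu]_(x in `[0%R, 1%R]) \int[mu]_(y in `[0%R, 1%R]) f (x, y))%E.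
Proof.
move=> hP mf f0; have mJ := measurable_unit_square.
rewrite ge0_integral_restrict_square//.
(* The density is 1 on every subset of the square, so [P] and [lebesgue2] agree there. *)
rewrite (@eq_measure_integral _ _ _ unit_square (@lebesgue2 R)); last first.
  move=> A mA AJ; rewrite -[RHS]mul1e -integral_cst//; rewrite [LHS]hP//.
  by apply: eq_integral => x /set_mem /AJ xJ; rewrite indicE mem_set.
(* Extended by 0 outside the square, the integrand lives on the whole plane and Tonelli applies;
   each vertical section of the square is [0, 1] or empty. *)
rewrite integral_mkcond fubini_tonelli1//; last 2 first.
  - by apply/(measurable_restrictT _ mJ); exact: measurable_funTS.
  - by move=> x; rewrite erestrict_ge0.
rewrite [RHS]integral_mkcond; apply: eq_integral => x _.
rewrite /fubini_F patchE; case: ifPn => [/set_mem xI|/negP xI].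
  rewrite [RHS]integral_mkcond; apply: eq_integral => y _.
  rewrite !patchE; congr (if _ then _ else _).
  apply/idP/idP => /set_mem h; apply/mem_set; move: h; rewrite unit_squareE /=.
    by case.
  by split.
apply: integral0_eq => y _; rewrite patchE ifF//.
apply/negP => /set_mem; rewrite unit_squareE => -[/= xI' _].
by apply: xI; exact/mem_set.
Qed.

Lemma ge0_le_integral_uniform_square P f g : uniform_distribution unit_square P ->
  measurable_fun [set: plane R] f -> measurable_fun [set: plane R] g ->
  (forall x, 0 <= f x)%E -> (forall x, 0 <= g x)%E ->
  (forall x, unit_square x -> f x <= g x)%E ->
  (\int[P]_x f x <= \int[P]_x g x)%E.
Proof.
move=> hP mf mg f0 g0 fg; rewrite !ge0_integral_restrict_square//.
apply: ge0_le_integral => //; first exact: measurable_unit_square.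
- exact: measurable_funTS.
- exact: measurable_funTS.
Qed.

End IntegralOverSquare.

(** * Integrals of functions of the distance to the midpoint *)

Section FoldedInterval.
Context {R : realType}.
Implicit Types (x k c : R) (n : nat) (phi Phi : R -> R).
Local Notation mu := (@lebesgue_measure R).

(** The costs are piecewise polynomial, with kinks that depend on parameters. Written with powers of
    positive parts, each has a single primitive on the whole interval, without a split at the
    kink. *)
Definition pospart x : R := Num.max x 0.

Lemma pospart_ge0 x : 0 <= pospart x.
Proof. by rewrite le_max lexx orbT. Qed.

Lemma ger0_pospart x : 0 <= x -> pospart x = x.
Proof. exact: max_l. Qed.

Lemma ler0_pospart x : x <= 0 -> pospart x = 0.
Proof. exact: max_r. Qed.

Lemma continuous_pospart : continuous pospart.
Proof.
move=> x; apply: (@continuous_max _ R (@id R) (cst 0)); first exact: cvg_id.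
exact: cvg_cst.
Qed.

(** The power is at least 2, so the function is differentiable at the kink 0: there the difference
    quotient is [pospart h ^+ n.+1], which tends to 0. *)
Lemma is_derive_pospartX n x :
  is_derive x 1 (fun y => pospart y ^+ n.+2) (n.+2%:R * pospart x ^+ n.+1).
Proof.
have [x0|x0|->] := ltgtP x 0.
- apply: (@near_eq_is_derive _ _ _ (cst 0)).
    by near=> y; rewrite ler0_pospart ?expr0n//; apply: ltW; near: y; exact: lt_nbhsl.
  by rewrite ler0_pospart ?ltW// expr0n/= mulr0; exact: is_derive_cst.
- apply: (@near_eq_is_derive _ _ _ ((@id R) ^+ n.+2)).
    near=> y; rewrite fctE ger0_pospart//; apply: ltW; near: y; exact: lt_nbhsr.
  rewrite ger0_pospart ?ltW//.
  by apply: is_derive_eq; rewrite /GRing.scale /= mulr1.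
rewrite (ler0_pospart (lexx 0)) expr0n mulr0.
have cp : pospart h ^+ n.+1 @[h --> 0^'] --> (0 : R).
  have p0 : pospart 0 ^+ n.+1 = 0 by rewrite ler0_pospart// expr0n.
  have : pospart h ^+ n.+1 @[h --> (0 : R)] --> pospart 0 ^+ n.+1.
    apply: (@continuous_comp _ _ _ pospart (fun z => z ^+ n.+1)).
      exact: continuous_pospart.
    exact: exprn_continuous.
  by rewrite p0; exact: cvg_within_filter.
have dq : h^-1 *: (((fun y => pospart y ^+ n.+2) \o shift 0) (h *: 1) -
    pospart 0 ^+ n.+2) @[h --> 0^'] --> (0 : R).
  apply: cvg_trans cp; apply: near_eq_cvg; near=> h.
  have h0 : h != 0 by near: h; exact: nbhs_dnbhs_neq.
  rewrite /GRing.scale/= addr0 mulr1 (ler0_pospart (lexx 0)) [0 ^+ _]expr0n subr0.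
  have [hp|hn] := leP 0 h.
    by rewrite ger0_pospart// [h ^+ n.+2]exprS mulKf.
  by rewrite ler0_pospart ?(ltW hn)// !expr0n/= mulr0.
by apply: DeriveDef; [apply: cvgP dq | apply/cvg_lim].
Unshelve. all: by end_near. Qed.

(** Continuity travels with the derivative because the fundamental theorem of calculus needs both;
    the closure lemmas below then assemble primitives summand by summand. *)
Definition primitive Phi phi :=
  continuous phi /\ forall x, is_derive x 1 Phi (phi x).

Lemma primitiveD Phi phi Psi psi : primitive Phi phi -> primitive Psi psi ->
  primitive (fun x => Phi x + Psi x) (fun x => phi x + psi x).
Proof.
move=> [cf df] [cg dg]; split=> x; first by apply: cvgD; [exact: cf|exact: cg].
exact: is_deriveD.
Qed.

Lemma primitiveZ c Phi phi : primitive Phi phi ->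
  primitive (fun x => c * Phi x) (fun x => c * phi x).
Proof.
move=> [cf df]; split=> x; last exact: is_deriveZ.
by apply: cvgM; [exact: cvg_cst|exact: cf].
Qed.

Lemma primitiveX n : primitive (fun x => x ^+ n.+1 / n.+1%:R) (fun x => x ^+ n).
Proof.
split=> x; first exact: exprn_continuous.
have -> : (fun x => x ^+ n.+1 / n.+1%:R) = n.+1%:R^-1 \*: (@id R) ^+ n.+1.
  by apply/funext => y; rewrite mulrC fctE.
by apply: is_derive_eq; rewrite /GRing.scale /= mulr1 mulKf.
Qed.

Lemma primitive_shift k Phi phi : primitive Phi phi ->
  primitive (fun x => Phi (x + k)) (fun x => phi (x + k)).
Proof.
move=> [cf df]; split=> x.
  apply: (@continuous_comp _ _ _ (shift k) phi); last exact: cf.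
  by apply: cvgD; [exact: cvg_id|exact: cvg_cst].
by have := is_derive1_comp (df (shift k x)) (is_derive_shift x 1 k); rewrite mulr1.
Qed.

Lemma primitive_opp Phi phi : primitive Phi phi ->
  primitive (fun x => - Phi (- x)) (fun x => phi (- x)).
Proof.
move=> [cf df]; split=> x.
  by apply: (@continuous_comp _ _ _ -%R phi); [exact: opp_continuous|exact: cf].
have /is_deriveN := is_derive1_comp (df (- x)) (is_deriveNid x 1).
by rewrite mulrN1 opprK.
Qed.

Lemma primitive_pospart k n :
  primitive (fun x => pospart (x + k) ^+ n.+2 / n.+2%:R)
            (fun x => pospart (x + k) ^+ n.+1).
Proof.
apply: (@primitive_shift k (fun x => pospart x ^+ n.+2 / n.+2%:R) (fun x => pospart x ^+ n.+1)).
split=> x.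
  apply: (@continuous_comp _ _ _ pospart (fun y => y ^+ n.+1)).
    exact: continuous_pospart.
  exact: exprn_continuous.
have -> : (fun x => pospart x ^+ n.+2 / n.+2%:R) =
    n.+2%:R^-1 \*: (fun y => pospart y ^+ n.+2).
  by apply/funext => y; rewrite mulrC.
have := is_deriveZ (n.+2%:R^-1) (is_derive_pospartX n x).
by rewrite [_ *: _]mulKf.
Qed.

Lemma integral_primitive Phi phi (a b : R) : a < b -> primitive Phi phi ->
  (\int[mu]_(y in `[a, b]) (phi y)%:E = (Phi b - Phi a)%:E)%E.
Proof.
move=> ab [cphi dPhi].
have cPhi : continuous Phi.
  by move=> x; apply/differentiable_continuous/derivable1_diffP; exact: ex_derive.
rewrite (continuous_FTC2 ab (F := Phi)) ?EFinB//.
- exact/continuous_subspaceT.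
- split; first by move=> x _; exact: ex_derive.
  + exact/cvg_at_right_filter/cPhi.
  + exact/cvg_at_left_filter/cPhi.
- by move=> x _; rewrite derive1E; exact: derive_val.
Qed.

(** The integrand is symmetric about 1/2, so each half of the interval contributes
    [Phi 2^-1 - Phi 0]. *)
Lemma integral_folded Phi phi : primitive Phi phi ->
  (\int[mu]_(y in `[0%R, 1%R]) (phi `|y - 2^-1|)%:E =
   (2 * (Phi 2^-1 - Phi 0))%:E)%E.
Proof.
move=> pr; have [cphi dPhi] := pr.
have cphi' : continuous (fun y : R => phi `|y - 2^-1|).
  move=> y; apply: continuous_comp; last exact: cphi.
  apply: continuous_comp; last exact: norm_continuous.
  by apply: cvgB; [exact: cvg_id|exact: cvg_cst].
have mphi := measurable_funTS (continuous_measurable_fun cphi').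
rewrite (@itv_bndbnd_setU _ _ _ (BRight (2^-1 : R))) ?bnd_simp; [|lra..].
rewrite integral_setU//=; last 2 first.
- by apply/measurable_EFinP; exact: mphi.
- by apply/disj_setPS => y [] /=; rewrite !in_itv/= => /andP[_ ?] /andP[? _]; lra.
rewrite integral_itv_obnd_cbnd; last first.
  by apply/measurable_EFinP; exact: mphi.
have -> : (\int[mu]_(y in `[0%R, 2^-1%R]) (phi `|y - 2^-1|)%:E =
    (Phi 2^-1 - Phi 0)%:E)%E.
  (* On the left half the primitive is y |-> - Phi (1/2 - y). *)
  have := integral_primitive _ (primitive_shift (- 2^-1) (primitive_opp pr)).
  move=> /(_ 0 2^-1); rewrite sub0r subrr opprK oppr0 opprK addrC => <-; last lra.
  apply: eq_integral => y /set_mem /=; rewrite in_itv/= => /andP[_ y2].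
  by rewrite ler0_norm ?subr_le0.
have -> : (\int[mu]_(y in `[2^-1%R, 1%R]) (phi `|y - 2^-1|)%:E =
    (Phi 2^-1 - Phi 0)%:E)%E.
  have := integral_primitive _ (primitive_shift (- 2^-1) pr).
  move=> /(_ 2^-1 1); rewrite subrr (_ : 1 - 2^-1 = 2^-1 :> R); last lra.
  move=> <-; last lra.
  apply: eq_integral => y /set_mem /=; rewrite in_itv/= => /andP[y2 _].
  by rewrite ger0_norm ?subr_ge0.
by rewrite -EFinD; congr (_%:E); ring.
Qed.
End FoldedInterval.

(** * Distortion of the two kinds of crosses *)

Section Distortion.
Context {R : realType}.
Implicit Types (P : probability (plane R) R) (A : {fset plane R}) (x a : plane R).
Local Notation mu := (@lebesgue_measure R).

Definition sqdist x a : R := (x.1 - a.1) ^+ 2 + (x.2 - a.2) ^+ 2.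

Lemma sqr_enorm x a : enorm (x - a) ^+ 2 = sqdist x a.
Proof. by rewrite /enorm sqr_sqrtr// addr_ge0// sqr_ge0. Qed.

Lemma sqdist_ge0 x a : 0 <= sqdist x a.
Proof. by rewrite addr_ge0// sqr_ge0. Qed.

Definition minsq A x : \bar R := \big[mine/+oo%E]_(a <- A) (enorm (x - a) ^+ 2)%:E.

Lemma le_minsq A x (c : \bar R) :
  (forall a, a \in A -> (c <= (sqdist x a)%:E)%E) -> (c <= minsq A x)%E.
Proof.
move=> h; rewrite /minsq big_seq; apply: le_bigmin; first exact: leey.
by move=> a aA; rewrite sqr_enorm; exact: h.
Qed.

Lemma minsq_le A x a : a \in A -> (minsq A x <= (sqdist x a)%:E)%E.
Proof.
move=> aA; rewrite /minsq -sqr_enorm.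
by apply: (bigmin_inf_seq _ a xpredT _ (fun b => (enorm (x - b) ^+ 2)%:E)).
Qed.

Lemma minsq_ge0 A x : (0 <= minsq A x)%E.
Proof. by apply: le_minsq => a _; rewrite lee_fin sqdist_ge0. Qed.

Lemma measurable_sqdist a : measurable_fun [set: plane R] (sqdist^~ a).
Proof.
apply: measurable_funD; apply: measurable_funX; apply: measurable_funB => //.
Qed.

Lemma measurable_minsq A : measurable_fun [set: plane R] (minsq A).
Proof.
rewrite /minsq; elim: (enum_fset A) => [|a s ih].
  by under eq_fun do rewrite big_nil; exact: measurable_cst.
under eq_fun do rewrite big_cons sqr_enorm.
apply: measurable_mine => //; apply/measurable_EFinP; exact: measurable_sqdist.
Qed.

Lemma integral_minsqE P A : distortion P A = (\int[P]_x minsq A x)%E.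
Proof. by []. Qed.

Definition off (y : R) : R := `|y - 2^-1|.

Lemma off_le (y : R) : y \in `[0, 1] -> off y <= 2^-1.
Proof. by rewrite in_itv /= => /andP[y0 y1]; rewrite ler_norml; apply/andP; split; lra. Qed.

Lemma sqr_off (y : R) : off y ^+ 2 = (y - 2^-1) ^+ 2.
Proof. by rewrite real_normK// num_real. Qed.

Lemma ler_off (y : R) : y - 2^-1 <= off y.
Proof. exact: ler_norm. Qed.

Lemma lerN_off (y : R) : - (y - 2^-1) <= off y.
Proof. by rewrite /off -normrN ler_norm. Qed.

Definition corner (s t : R) : plane R := (2^-1 + s, 2^-1 + t).

Definition saltire (t : R) : {fset plane R} :=
  [fset Defs.center; corner t t; corner (- t) t; corner (- t) (- t);
        corner t (- t)]%fset.

(* With u = off x.1 and v = off x.2, the corner nearest to x is at squared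
   distance u^2 + v^2 - 2t (u + v - t), which beats the center iff u + v > t. *)
Definition saltire_sq (t : R) x : R :=
  off x.1 ^+ 2 + off x.2 ^+ 2 - 2 * t * pospart (off x.1 + off x.2 - t).

Lemma minsq_saltire t x : 0 <= t -> minsq (saltire t) x = (saltire_sq t x)%:E.
Proof.
move=> t0; apply/eqP; rewrite eq_le; apply/andP; split; last first.
  (* The signs s1, s2 select a corner. After expansion the claim is that t times s1 (x_1 - 1/2) + s2
     (x_2 - 1/2) - t is at most t times the positive part. *)
  have key (s1 s2 : R) : s1 * (x.1 - 2^-1) <= off x.1 -> s2 * (x.2 - 2^-1) <= off x.2 ->
      s1 ^+ 2 = 1 -> s2 ^+ 2 = 1 ->
      saltire_sq t x <= sqdist x (corner (s1 * t) (s2 * t)).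
    move=> h1 h2 e1 e2; rewrite /saltire_sq /sqdist /= !sqr_off.
    have hp : off x.1 + off x.2 - t <= pospart (off x.1 + off x.2 - t).
      by rewrite le_max lexx.
    set p := pospart _ in hp *.
    have -> : (x.1 - (2^-1 + s1 * t)) ^+ 2 + (x.2 - (2^-1 + s2 * t)) ^+ 2 =
      (x.1 - 2^-1) ^+ 2 + (x.2 - 2^-1) ^+ 2 - 2 * t * (s1 * (x.1 - 2^-1) + s2 * (x.2 - 2^-1))
      + (s1 ^+ 2 + s2 ^+ 2) * t ^+ 2 by ring.
    rewrite e1 e2.
    have : 0 <= t * (p - (s1 * (x.1 - 2^-1) + s2 * (x.2 - 2^-1) - t)).
      by rewrite mulr_ge0//; lra.
    by nra.
  apply: le_minsq => a; rewrite !inE lee_fin.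
  move=> /orP[/orP[/orP[/orP[]|]|]|] /eqP ->.
  - rewrite /saltire_sq /sqdist /= !sqr_off.
    by rewrite gerBl// !mulr_ge0// pospart_ge0.
  - by have := key 1 1; rewrite !mul1r expr1n; apply; rewrite ?ler_off.
  - by have := key (-1) 1; rewrite !mulN1r !mul1r sqrrN expr1n; apply; rewrite ?ler_off ?lerN_off.
  - by have := key (-1) (-1); rewrite !mulN1r sqrrN expr1n; apply; rewrite ?lerN_off.
  - by have := key 1 (-1); rewrite !mulN1r !mul1r sqrrN expr1n; apply; rewrite ?ler_off ?lerN_off.
have [h|h] := leP (off x.1 + off x.2) t.
  apply: (le_trans (minsq_le _ (a := Defs.center) _)); first by rewrite !inE eqxx.
  rewrite lee_fin /saltire_sq ler0_pospart ?subr_le0// mulr0 subr0 !sqr_off.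
  by rewrite /sqdist.
have key (s1 s2 : R) : s1 * (x.1 - 2^-1) = off x.1 -> s2 * (x.2 - 2^-1) = off x.2 ->
    s1 ^+ 2 = 1 -> s2 ^+ 2 = 1 ->
    sqdist x (corner (s1 * t) (s2 * t)) = saltire_sq t x.
  move=> h1 h2 e1 e2; rewrite /saltire_sq /sqdist ger0_pospart ?subr_ge0 1?ltW//= !sqr_off -h1 -h2.
  rewrite (_ : 2 * t * _ =
    2 * t * (s1 * (x.1 - 2^-1) + s2 * (x.2 - 2^-1)) - (s1 ^+ 2 + s2 ^+ 2) * t ^+ 2); first by ring.
  by rewrite e1 e2; ring.
have attained (s1 s2 : R) : corner (s1 * t) (s2 * t) \in saltire t ->
    s1 * (x.1 - 2^-1) = off x.1 -> s2 * (x.2 - 2^-1) = off x.2 ->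
    s1 ^+ 2 = 1 -> s2 ^+ 2 = 1 -> (minsq (saltire t) x <= (saltire_sq t x)%:E)%E.
  by move=> h0 h1 h2 h3 h4; rewrite -(key s1 s2)//; exact: minsq_le.
(* Taking each sign from the side of 1/2 on which the coordinate lies selects the corner in the
   quadrant of x, where the bound is attained. *)
have offE (y : R) : exists s : R, [/\ s = 1 \/ s = -1, s * (y - 2^-1) = off y & s ^+ 2 = 1].
  have [y0|y0] := lerP 2^-1 y; [exists 1|exists (-1)].
    by rewrite mul1r expr1n /off ger0_norm ?subr_ge0//; split=> //; left.
  by rewrite mulN1r sqrrN expr1n /off ltr0_norm ?subr_lt0//; split=> //; right.
have [s1 [e1 h1 q1]] := offE x.1; have [s2 [e2 h2 q2]] := offE x.2.
apply: (attained s1 s2) => //.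
by case: e1 => ->; case: e2 => ->; rewrite ?mul1r ?mulN1r !inE eqxx ?orbT.
Qed.

Definition saltire_error (t : R) : R :=
  1 / 6 - t + 2 * t ^+ 2 - 4 / 3 * t ^+ 4.

Lemma distortion_saltire P t : uniform_distribution unit_square P ->
  0 <= t <= 2^-1 -> distortion P (saltire t) = (saltire_error t)%:E.
Proof.
move=> hP /andP[t0 t1]; rewrite integral_minsqE ge0_integral_uniform_square//; last 2 first.
- exact: measurable_minsq.
- exact: minsq_ge0.
(* The integral over y when [off x] is c: 1/12 is the integral of (y - 1/2)^2, and the two squares
   are the primitive of the positive part at the ends 1/2 and 0 of the folded interval. The factor
   [c ^+ 0] matches the shape of [primitiveX 0]. *)
pose inner (c : R) := c ^+ 2 + 12^-1 * c ^+ 0 +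
  (- (2 * t) * pospart (c + (2^-1 - t)) ^+ 2 + 2 * t * pospart (c + - t) ^+ 2).
have pr_inner := primitiveD (primitiveD (primitiveX 2) (primitiveZ 12^-1 (primitiveX 0)))
  (primitiveD (primitiveZ (- (2 * t)) (primitive_pospart (2^-1 - t) 1))
              (primitiveZ (2 * t) (primitive_pospart (- t) 1))).
transitivity (\int[mu]_(x in `[0%R, 1%R]) (inner `|x - 2^-1|)%:E)%E.
  apply: eq_integral => x _.
  pose c := off x.
  have pr := primitiveD (primitiveD (primitiveZ (c ^+ 2) (primitiveX 0)) (primitiveX 2))
    (primitiveZ (- (2 * t)) (primitive_pospart (c - t) 0)).
  have -> : (inner `|x - 2^-1|)%:E = (\int[mu]_(y in `[0%R, 1%R])
      (c ^+ 2 * `|y - 2^-1| ^+ 0 + `|y - 2^-1| ^+ 2 +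
       - (2 * t) * pospart (`|y - 2^-1| + (c - t)) ^+ 1)%:E)%E.
    rewrite (integral_folded pr); congr (_%:E).
    rewrite /inner -/(off x) -/c.
    rewrite (_ : 0 + (c - t) = c - t); last by ring.
    rewrite (_ : 2^-1 + (c - t) = c + (2^-1 - t)); last by ring.
    by field.
  apply: eq_integral => y _; rewrite minsq_saltire// /saltire_sq /= -/c; congr (_%:E).
  rewrite expr0 mulr1 expr1 /off (addrC _ (c - t)) (addrAC c); ring.
apply: (eq_trans (integral_folded pr_inner)); congr (_%:E).
(* The bounds 0 <= t <= 1/2 fix the sign of every positive part at the end points. *)
rewrite (@ger0_pospart _ (2^-1 + (2^-1 - t))); last lra.
rewrite (@ger0_pospart _ (0 + (2^-1 - t))); last lra.
rewrite (@ger0_pospart _ (2^-1 + - t)); last lra.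
rewrite (@ler0_pospart _ (0 + - t)); last lra.
by rewrite /saltire_error; field.
Qed.

(** The squared distance from x to the union of the lines x_1 = 1/2 and x_2 = 1/2. *)
Definition arm_sq x : R := Num.min (off x.1 ^+ 2) (off x.2 ^+ 2).

Lemma arm_sq_ge0 x : 0 <= arm_sq x.
Proof. by rewrite le_min !sqr_ge0. Qed.

Lemma measurable_arm_sq : measurable_fun [set: plane R] arm_sq.
Proof.
apply: measurable_minr; under eq_fun do rewrite sqr_off;
  by apply: measurable_funX; apply: measurable_funB.
Qed.

Lemma integral_arm_sq P : uniform_distribution unit_square P ->
  (\int[P]_x (arm_sq x)%:E = (1 / 24)%:E)%E.
Proof.
move=> hP; rewrite ge0_integral_uniform_square//; last 2 first.
- by apply/measurable_EFinP; exact: measurable_arm_sq.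
- by move=> x; rewrite lee_fin arm_sq_ge0.
(* For c = [off x] in [0, 1/2] the inner integral will turn out to be c^2 - 4c^3/3. *)
have pr_inner := primitiveD (primitiveX 2) (primitiveZ (- (4 / 3) : R) (primitiveX 3)).
transitivity (\int[mu]_(x in `[0%R, 1%R]) (`|x - 2^-1| ^+ 2 + - (4 / 3) * `|x - 2^-1| ^+ 3)%:E)%E.
  apply: eq_integral => x xI.
  pose c := off x.
  have c0 : 0 <= c by exact: normr_ge0.
  have c1 : c <= 2^-1 by apply: off_le; exact: set_mem xI.
  (* min(c, v)^2 = v^2 - (v - c)_+^2 - 2c (v - c)_+ *)
  have pr := primitiveD (primitiveX 2) (primitiveD
    (primitiveZ (- 1) (primitive_pospart (- c) 1))
    (primitiveZ (- (2 * c)) (primitive_pospart (- c) 0))).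
  transitivity (\int[mu]_(y in `[0%R, 1%R])
    (`|y - 2^-1| ^+ 2 + (- 1 * pospart (`|y - 2^-1| + - c) ^+ 2 +
     - (2 * c) * pospart (`|y - 2^-1| + - c) ^+ 1))%:E)%E.
    apply: eq_integral => y _; congr (_%:E).
    rewrite /arm_sq /= -/c -/(off y).
    have y0 : 0 <= off y by exact: normr_ge0.
    have [cy|yc] := leP c (off y).
      rewrite min_l ?ler_sqr// ger0_pospart ?subr_ge0//; ring.
    rewrite min_r ?ler_sqr ?ltW// ler0_pospart ?subr_le0 ?ltW//; ring.
  rewrite (integral_folded pr); congr (_%:E).
  rewrite (@ger0_pospart _ (2^-1 + - c)); last lra.
  rewrite (@ler0_pospart _ (0 + - c)); last lra.
  by rewrite -/(off x) -/c; field.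
rewrite (integral_folded pr_inner); congr (_%:E).
by field.
Qed.
End Distortion.

(** * Existence of optimal sets *)

Section Existence.
Context {R : realType}.
Implicit Types (P : probability (plane R) R) (A : {fset plane R}) (x a b : plane R).

Definition clamp (y : R) : R := Num.max 0 (Num.min y 1).

Lemma clamp_itv (y : R) : 0 <= clamp y <= 1.
Proof. by rewrite /clamp le_max lexx ge_max ler01 ge_min lexx orbT. Qed.

Lemma clamp_le (x y : R) : 0 <= x <= 1 -> (x - clamp y) ^+ 2 <= (x - y) ^+ 2.
Proof.
move=> /andP[x0 x1]; rewrite /clamp.
have [y1|y1] := leP y 1; last by rewrite max_r ?ler01//; nra.
have [y0|y0] := leP 0 y; [by []|nra].
Qed.

Definition clamp2 a : plane R := (clamp a.1, clamp a.2).

Lemma unit_square_clamp2 a : unit_square (clamp2 a).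
Proof. by split; exact: clamp_itv. Qed.

Lemma sqdist_clamp2 x a : unit_square x -> sqdist x (clamp2 a) <= sqdist x a.
Proof. by move=> [x1 x2]; apply: lerD; exact: clamp_le. Qed.

(** Candidate sets are parametrized by a row of first coordinates and a row of second coordinates,
    which gives a normed parameter space with a compact cube. Entries may repeat, so sets with fewer
    than n points are covered too. *)
Definition pt n (v : ('rV[R]_n * 'rV[R]_n)%type) (i : 'I_n) : plane R :=
  (v.1 ord0 i, v.2 ord0 i).

Definition points n (v : ('rV[R]_n * 'rV[R]_n)%type) : {fset plane R} :=
  [fset pt v i | i in 'I_n]%fset.

Lemma pointsP n (v : ('rV[R]_n * 'rV[R]_n)%type) a :
  reflect (exists i, a = pt v i) (a \in points v).
Proof.
apply: (iffP (imfsetP _ _ _ _)) => [[i _ ->]|[i ->]]; by exists i.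
Qed.

Lemma card_points n (v : ('rV[R]_n * 'rV[R]_n)%type) : (#|` points v| <= n)%N.
Proof.
by apply: (leq_trans (leq_imfset_card _ _ _)); rewrite -cardE card_ord.
Qed.

Definition cube n : set ('rV[R]_n * 'rV[R]_n)%type :=
  [set v | forall i, unit_square (pt v i)].

Lemma compact_cube n : compact (@cube n).
Proof.
have cK : compact [set v : 'rV[R]_n | forall i, `[0, 1]%classic (v ord0 i)].
  by apply: (@rV_compact R n (fun=> `[0, 1]%classic)) => _; exact: segment_compact.
rewrite (_ : @cube n = [set v : 'rV[R]_n | forall i, `[0, 1]%classic (v ord0 i)] `*`
  [set v : 'rV[R]_n | forall i, `[0, 1]%classic (v ord0 i)]); first exact: compact_setX.
apply/seteqP; split=> v /=.
  by move=> Kv; split=> i; have [] := Kv i; rewrite /= in_itv.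
move=> [K1 K2] i; have := K1 i; have := K2 i; rewrite /= !in_itv /= => ? ?.
by split.
Qed.

(* When A has fewer than n points, the missing ones repeat its first point. *)
Definition clamped n A : ('rV[R]_n * 'rV[R]_n)%type :=
  (\row_i clamp (nth (head Defs.center A) A i).1,
   \row_i clamp (nth (head Defs.center A) A i).2).

Lemma pt_clamped n A i :
  pt (clamped n A) i = clamp2 (nth (head Defs.center A) A i).
Proof. by rewrite /pt /= !mxE. Qed.

Lemma cube_clamped n A : cube (clamped n A).
Proof. by move=> i; rewrite pt_clamped; exact: unit_square_clamp2. Qed.

Lemma minsq_points_clamp n A x : (#|` A| <= n)%N -> unit_square x ->
  (minsq (points (clamped n A)) x <= minsq A x)%E.
Proof.
move=> cA xJ; apply: le_minsq => a aA.
(* The cardinality bound guarantees that every point of [A] occurs among the n entries of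
   [clamped n A], up to projection. *)
have ia : (index a A < n)%N by rewrite (leq_trans _ cA)// index_mem.
apply: (@le_trans _ _ (sqdist x (clamp2 a))%:E); last first.
  by rewrite lee_fin; exact: sqdist_clamp2.
apply: minsq_le; apply/pointsP; exists (Ordinal ia).
by rewrite pt_clamped /= nth_index.
Qed.

(** In each coordinate (y - s)^2 - (y - t)^2 = (t - s)(2y - s - t), whose last factor is at most 2
    in absolute value on [0, 1]; two coordinates give 4d. *)
Lemma sqdist_lip x a b (d : R) : unit_square x -> unit_square a -> unit_square b ->
  `|a.1 - b.1| <= d -> `|a.2 - b.2| <= d -> sqdist x a <= sqdist x b + 4 * d.
Proof.
have key (y s t : R) : 0 <= y <= 1 -> 0 <= s <= 1 -> 0 <= t <= 1 -> `|s - t| <= d ->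
    (y - s) ^+ 2 <= (y - t) ^+ 2 + 2 * d.
  move=> /andP[y0 y1] /andP[s0 s1] /andP[t0 t1]; rewrite ler_norml => /andP[h1 h2].
  by have [st|st] := leP s t; nra.
move=> [x1 x2] [a1 a2] [b1 b2] h1 h2; rewrite /sqdist.
have := key _ _ _ x1 a1 b1 h1; have := key _ _ _ x2 a2 b2 h2; lra.
Qed.

Lemma minsq_lip n (v w : ('rV[R]_n * 'rV[R]_n)%type) x (d : R) :
  cube v -> cube w -> unit_square x ->
  (forall i, `|v.1 ord0 i - w.1 ord0 i| <= d) ->
  (forall i, `|v.2 ord0 i - w.2 ord0 i| <= d) ->
  (minsq (points v) x <= minsq (points w) x + (4 * d)%:E)%E.
Proof.
move=> Kv Kw xJ h1 h2; rewrite -leeBlDr//; apply: le_minsq => b /pointsP[i ->].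
rewrite leeBlDr//; apply: (@le_trans _ _ (sqdist x (pt v i))%:E).
  by apply: minsq_le; apply/pointsP; exists i.
by rewrite -EFinD lee_fin; apply: sqdist_lip => //=.
Qed.

Lemma integral_cst_prob P (r : R) : (\int[P]_x r%:E = r%:E)%E.
Proof. rewrite integral_cst// -[RHS]mule1; congr (_ * _)%E; exact: probability_setT. Qed.

Lemma distortion_ge0 P A : (0 <= distortion P A)%E.
Proof. by apply: integral_ge0 => x _; exact: minsq_ge0. Qed.

Lemma le_distortion P A B : uniform_distribution unit_square P ->
  (forall x, unit_square x -> (minsq A x <= minsq B x)%E) ->
  (distortion P A <= distortion P B)%E.
Proof.
move=> hP h; rewrite !integral_minsqE; apply: ge0_le_integral_uniform_square => //;
  by [exact: measurable_minsq|exact: minsq_ge0].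
Qed.

Lemma distortion_points_lip P n (v w : ('rV[R]_n * 'rV[R]_n)%type) (d : R) :
  uniform_distribution unit_square P -> 0 <= d -> cube v -> cube w ->
  (forall i, `|v.1 ord0 i - w.1 ord0 i| <= d) ->
  (forall i, `|v.2 ord0 i - w.2 ord0 i| <= d) ->
  (distortion P (points v) <= distortion P (points w) + (4 * d)%:E)%E.
Proof.
move=> hP d0 Kv Kw h1 h2; rewrite !integral_minsqE -(integral_cst_prob P).
rewrite -ge0_integralD//; last 3 first.
- by move=> x _; exact: minsq_ge0.
- exact: measurable_minsq.
- by move=> x _; rewrite lee_fin mulr_ge0.
apply: ge0_le_integral_uniform_square => //.
- exact: measurable_minsq.
- by apply: emeasurable_funD => //; exact: measurable_minsq.
- exact: minsq_ge0.
- by move=> x; rewrite adde_ge0 ?minsq_ge0// lee_fin mulr_ge0.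
- by move=> x xJ; exact: minsq_lip.
Qed.

Lemma distortion_points_fin P n (v : ('rV[R]_n.+1 * 'rV[R]_n.+1)%type) :
  uniform_distribution unit_square P -> cube v ->
  distortion P (points v) \is a fin_num.
Proof.
move=> hP Kv; rewrite ge0_fin_numE ?distortion_ge0//.
(* 2 is the squared diameter of the square. The index [n.+1] supplies the one point [pt v ord0] that
   the bound uses. *)
apply: (@le_lt_trans _ _ 2%:E); last exact: ltry.
rewrite integral_minsqE -(integral_cst_prob P).
apply: ge0_le_integral_uniform_square => //.
- exact: measurable_minsq.
- exact: minsq_ge0.
- move=> x xJ; apply: (le_trans (minsq_le _ (a := pt v ord0) _)).
    by apply/pointsP; exists ord0.
  rewrite lee_fin; move: (Kv ord0) xJ => [] + + [].
  rewrite /sqdist => /andP[? ?] /andP[? ?] /andP[? ?] /andP[? ?]; nra.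
Qed.

Lemma continuous_distortion_points P n : uniform_distribution unit_square P ->
  {within @cube n.+1, continuous (fun v => fine (distortion P (points v)))}.
Proof.
move=> hP; apply/subspace_continuousP => v Kv.
apply/cvgrPdist_le => e e0.
(* The radius e / 4 compensates the Lipschitz constant 4. *)
have d0 : 0 < e / 4 by rewrite divr_gt0.
rewrite near_withinE.
have : \forall w \near v, ball v (e / 4) w by exact: near_ball.
apply: filterS => w [[_ b1] [_ b2]] Kw.
have h1 i : `|v.1 ord0 i - w.1 ord0 i| <= e / 4 by exact: ltW (b1 ord0 i).
have h2 i : `|v.2 ord0 i - w.2 ord0 i| <= e / 4 by exact: ltW (b2 ord0 i).
have e4 : 4 * (e / 4) = e by field.
have := distortion_points_lip hP (ltW d0) Kv Kw h1 h2.
have := @distortion_points_lip P _ w v (e / 4) hP (ltW d0) Kw Kv.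
rewrite e4 -(fineK (distortion_points_fin hP Kv)) -(fineK (distortion_points_fin hP Kw)).
rewrite -!EFinD !lee_fin => wv vw.
rewrite /from_subspace/= ler_norml; apply/andP; split; last lra.
rewrite lerBrDl -lerBrDr opprK; apply: wv => i; rewrite distrC//.
Qed.

Lemma exists_optimal_means P n : uniform_distribution unit_square P ->
  exists A, optimal_means P n.+1 A.
Proof.
move=> hP.
(* The empty set has no first point, so all entries here come from the default [center]. *)
have K0 : @cube n.+1 !=set0 by exists (clamped n.+1 fset0); exact: cube_clamped.
have [v] := compact_EVT_min K0 (@compact_cube n.+1) (@continuous_distortion_points P n hP).
move=> /set_mem Kv vmin; exists (points v); split; first exact: card_points.
apply/eqP; rewrite eq_le; apply/andP; split; last first.
  by apply: ereal_inf_lbound; exists (points v) => //; exact: card_points.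
(* Any competitor is at least as costly as its projection, which belongs to the cube over which [v]
   is minimal. *)
apply: le_ereal_inf_tmp => _ [A /= cA <-].
apply: (@le_trans _ _ (distortion P (points (clamped n.+1 A)))); last first.
  by apply: le_distortion => // x; exact: minsq_points_clamp.
rewrite -(fineK (distortion_points_fin hP Kv)).
rewrite -(fineK (distortion_points_fin hP (cube_clamped A))) lee_fin.
by apply: vmin; apply/mem_set; exact: cube_clamped.
Qed.

End Existence.

(** * Optimal sets of five-means *)

Section FiveMeans.
Context {R : realType}.
Implicit Types (P : probability (plane R) R) (A : {fset plane R}) (x a b : plane R).

Lemma critical_saltire : exists s : R,
  2789 / 10 ^+ 4 + 373 / 10 ^+ 7 <= s <= 2789 / 10 ^+ 4 + 374 / 10 ^+ 7 /\
  1 - 4 * s + 16 / 3 * s ^+ 3 = 0.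
Proof.
(* This is the derivative of [saltire_error]; it changes sign from negative to positive on the
   interval, as the intermediate value theorem requires. *)
pose p : {poly R} := (- 1)%:P + 4%:P * 'X - (16 / 3)%:P * 'X^3.
have pE (y : R) : p.[y] = - 1 + 4 * y - 16 / 3 * y ^+ 3 by rewrite /p !hornerE.
have [||s hs /rootP] := @poly_ivt R p (2789 / 10 ^+ 4 + 373 / 10 ^+ 7) (2789 / 10 ^+ 4 + 374 / 10 ^+ 7).
- lra.
- by rewrite !pE; apply/andP; split; lra.
by rewrite pE => ps; exists s; split=> //; lra.
Qed.

(** The hypothesis says that s is a critical point, so the double factor (t - s)^2 splits off.
    Without it the two sides differ by (s - t) times the cubic. *)
Lemma saltire_errorB (s t : R) : 1 - 4 * s + 16 / 3 * s ^+ 3 = 0 ->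
  saltire_error t - saltire_error s =
  (t - s) ^+ 2 * (2 - 4 / 3 * (t ^+ 2 + 2 * t * s + 3 * s ^+ 2)).
Proof.
move=> e; apply/eqP; rewrite -subr_eq0; apply/eqP.
transitivity ((s - t) * (1 - 4 * s + 16 / 3 * s ^+ 3)); last by rewrite e mulr0.
by rewrite /saltire_error; field.
Qed.

Lemma saltire_error_eq (s t : R) : 1 - 4 * s + 16 / 3 * s ^+ 3 = 0 ->
  0 <= s <= 3 / 10 -> 0 <= t <= 2^-1 -> saltire_error t <= saltire_error s -> t = s.
Proof.
move=> e /andP[s0 s1] /andP[t0 t1]; rewrite -subr_le0 saltire_errorB//.
(* With t <= 1/2 and s <= 3/10 the bracket is at most 0.82, below the critical value 3/2. *)
have q : 0 < 2 - 4 / 3 * (t ^+ 2 + 2 * t * s + 3 * s ^+ 2) by nra.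
rewrite pmulr_lle0// => h; apply/eqP; rewrite -subr_eq0 -sqrf_eq0.
by rewrite eq_le h sqr_ge0.
Qed.

(** Reducing the quartic modulo the cubic leaves a quadratic, which is easier to enclose
    numerically. *)
Lemma saltire_error_critical (s : R) : 1 - 4 * s + 16 / 3 * s ^+ 3 = 0 ->
  saltire_error s = 1 / 6 - 3 / 4 * s + s ^+ 2.
Proof.
move=> e; have e3 : s ^+ 3 = 3 / 16 * (4 * s - 1) by lra.
by rewrite /saltire_error (exprS s 3) e3; field.
Qed.

Lemma saltire_error_critical_approx (s : R) : 1 - 4 * s + 16 / 3 * s ^+ 3 = 0 ->
  2789 / 10 ^+ 4 + 373 / 10 ^+ 7 <= s <= 2789 / 10 ^+ 4 + 374 / 10 ^+ 7 ->
  `|saltire_error s - (35 / 10 ^+ 3 + 2697 / 10 ^+ 7)| < 1 / 10 ^+ 7.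
Proof.
move=> e /andP[s1 s2]; rewrite saltire_error_critical//.
set lo := 2789 / 10 ^+ 4 + 373 / 10 ^+ 7 in s1.
set hi := 2789 / 10 ^+ 4 + 374 / 10 ^+ 7 in s2.
(* On [lo, hi] the parabola s^2 lies below its chord and above its tangent at lo. These two bounds
   make the estimate linear in s. *)
have ub : 0 <= (s - lo) * (hi - s) by rewrite mulr_ge0// subr_ge0.
have lb : 0 <= (s - lo) ^+ 2 by exact: sqr_ge0.
have {}ub : s ^+ 2 <= (lo + hi) * s - lo * hi.
  by rewrite -subr_ge0 (_ : _ - _ = (s - lo) * (hi - s))//; ring.
have {}lb : 2 * lo * s - lo ^+ 2 <= s ^+ 2.
  by rewrite -subr_ge0 (_ : _ - _ = (s - lo) ^+ 2)//; ring.
rewrite /lo /hi in s1 s2 ub lb; rewrite ltr_norml; apply/andP; split.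
  by clear -s1 s2 lb; lra.
by clear -s1 s2 ub; lra.
Qed.

(* For t >= 1/2 the cost is pointwise at least that of t = 1/2, because
   off x.1 + off x.2 <= 1 on the square. *)
Lemma distortion_saltire_ge P (t : R) : uniform_distribution unit_square P ->
  2^-1 <= t -> ((1 / 12)%:E <= distortion P (saltire t))%E.
Proof.
move=> hP t2; apply: (@le_trans _ _ (distortion P (saltire 2^-1))).
  rewrite distortion_saltire// ?lexx ?andbT ?invr_ge0// lee_fin /saltire_error; lra.
apply: le_distortion => // -[x y] [/= x1 y1].
rewrite !minsq_saltire ?(le_trans _ t2) ?invr_ge0// lee_fin /saltire_sq lerD2l lerN2 /=.
have ox := off_le x1; have oy := off_le y1.
rewrite mulfV// mul1r.
have p0 := pospart_ge0 (off x + off y - 2^-1).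
have [h|h] := leP (off x + off y) t.
  by rewrite (@ler0_pospart _ (_ - t)) ?subr_le0// mulr0.
rewrite !ger0_pospart; [nra|lra..].
Qed.

(** A point of the line x_1 = 1/2 is at squared distance at least (x_1 - 1/2)^2 from x, and likewise
    for the other line; so [arm_sq] bounds the cost from below wherever the points sit on the
    lines. *)
Lemma distortion_arms_ge P A : uniform_distribution unit_square P ->
  (forall a, a \in A -> (a.1 == 2^-1) || (a.2 == 2^-1)) ->
  ((1 / 24)%:E <= distortion P A)%E.
Proof.
move=> hP hA; rewrite integral_minsqE -(integral_arm_sq hP).
apply: ge0_le_integral_uniform_square => //.
- by apply/measurable_EFinP; exact: measurable_arm_sq.
- exact: measurable_minsq.
- by move=> x; rewrite lee_fin arm_sq_ge0.
- exact: minsq_ge0.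
- move=> x _; apply: le_minsq => a /hA; rewrite lee_fin /sqdist /arm_sq ge_min !sqr_off.
  by move=> /orP[] /eqP ->; rewrite ?lerDl ?lerDr ?sqr_ge0 ?orbT.
Qed.

(** Only an upper bound holds for every t: at t = 0 the five points coincide. *)
Lemma card_saltire (t : R) : (#|` saltire t| <= 5)%N.
Proof.
have card1 A a : (#|` (A `|` [fset a])%fset| <= #|` A|.+1)%N.
  by rewrite cardfsU cardfs1 addn1 leq_subr.
do 4 (apply: (leq_trans (card1 _ _)); rewrite ltnS).
by rewrite cardfs1.
Qed.

Lemma centered_crossP A : centered_cross A ->
  (forall a, a \in A -> (a.1 == 2^-1) || (a.2 == 2^-1)) \/
  exists2 t : R, 0 <= t & A = saltire t.
Proof.
move=> [cA [cB [r Br] []]] [Bl _ _].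
  left=> a aA; have [->|ac] := eqVneq a Defs.center; first by rewrite eqxx.
  by apply: Bl; rewrite !inE ac.
right.
have dist a : a \in (A `\ Defs.center)%fset -> 2 * (a.1 - 2^-1) ^+ 2 = r ^+ 2.
  move=> aB; rewrite -(Br a aB) sqr_enorm /sqdist /=.
  by have /orP[/eqP ->|/eqP ->] := Bl a aB; field.
(* On a diagonal both coordinates are equally far from 1/2, so a point at distance r has offsets of
   absolute value sqrt(r^2 / 2). *)
exists (Num.sqrt (r ^+ 2 / 2)); first exact: sqrtr_ge0.
set t := Num.sqrt _.
have t2 : t ^+ 2 = r ^+ 2 / 2 by rewrite sqr_sqrtr// divr_ge0// sqr_ge0.
(* Inclusion of [A] in the saltire suffices, since [A] has five elements and the saltire at most
   five. *)
apply/eqP; rewrite eqEfcard; apply/andP; split; last first.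
  by rewrite (leq_trans (card_saltire t))// (cardfsD1 Defs.center) cA cB.
apply/fsubsetP => a aA; have [->|ac] := eqVneq a Defs.center.
  by rewrite !inE eqxx.
have aB : a \in (A `\ Defs.center)%fset by rewrite !inE ac.
have : (a.1 - 2^-1) ^+ 2 == t ^+ 2 by rewrite t2 -(dist a aB); apply/eqP; field.
have := Bl a aB; case: a {aA ac aB} => [a1 a2] /=.
have e1 : 1 - (t + 2^-1) = 2^-1 - t by field.
have e2 : 1 - (- t + 2^-1) = 2^-1 + t by field.
rewrite eqf_sqr !subr_eq => /orP[] /eqP -> /orP[] /eqP ->; rewrite !inE /corner;
  by rewrite ?e1 ?e2 ?(addrC _ 2^-1) ?eqxx ?orbT.
Qed.

End FiveMeans.

(* The literals are split so that they stay small: numerals of ring_scope are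
   unary, and Rocq overflows its stack on larger ones. *)
Theorem theorem3p8p1 (R : realType) (P : probability (plane R) R)
  (hP : uniform_distribution unit_square P)
  (hcross : forall A, optimal_means P 5 A -> centered_cross A) :
  (exists A : {fset plane R},
    [/\ optimal_means P 5 A,
        forall B, optimal_means P 5 B -> B = A
      & let e : R := 1 / 10 ^+ 6 in
        let u : R := 778 / 10 ^+ 3 + 937 / 10 ^+ 6 in (* 0.778937 *)
        let v : R := 221 / 10 ^+ 3 + 63 / 10 ^+ 6 in  (* 0.221063 *)
        exists p0 p1 p2 p3 p4 : plane R,
          A = [fset p0; p1; p2; p3; p4]%fset /\
          [/\ close_coords e p0 (1 / 2, 1 / 2), close_coords e p1 (u, u),
              close_coords e p2 (v, u), close_coords e p3 (v, v) & close_coords e p4 (u, v)]])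
  /\ (`| quantization_error P 5 -
         (35 / 10 ^+ 3 + 2697 / 10 ^+ 7 (* 0.0352697 *))%:E |
      < (1 / 10 ^+ 7)%:E)%E.
Proof.
have [s [/andP[s1 s2] crit]] := @critical_saltire R.
have [s0 s3 s5] : [/\ 0 <= s, s <= 3 / 10 & s <= 2^-1] by split; lra.
have sle : 0 <= s <= 2^-1 by rewrite s0.
have near_u : `|2^-1 + s - (778 / 10 ^+ 3 + 937 / 10 ^+ 6)| <= 1 / 10 ^+ 6.
  by rewrite ler_norml; apply/andP; split; clear -s1 s2; lra.
have near_v : `|2^-1 - s - (221 / 10 ^+ 3 + 63 / 10 ^+ 6)| <= 1 / 10 ^+ 6.
  by rewrite ler_norml; apply/andP; split; clear -s1 s2; lra.
have approx : `|saltire_error s - (35 / 10 ^+ 3 + 2697 / 10 ^+ 7)| < 1 / 10 ^+ 7.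
  by apply: saltire_error_critical_approx => //; apply/andP.
have [err24 err12] : saltire_error s < 1 / 24 /\ saltire_error s < 1 / 12.
  by move: approx; rewrite ltr_norml => /andP[_]; clear => ?; split; lra.
have qe_le : (quantization_error P 5 <= (saltire_error s)%:E)%E.
  rewrite -(distortion_saltire hP sle); apply: ereal_inf_lbound.
  by exists (saltire s) => //=; exact: card_saltire.
(* The value at s bounds the distortion of every optimal set. This excludes points on the two lines
   (at least 1/24) and t > 1/2 (at least 1/12), and for t <= 1/2 it forces t = s. *)
have opt A : optimal_means P 5 A -> A = saltire s.
  move=> oA; have [_ dA] := oA; rewrite -dA in qe_le.
  have [arms|[t t0 At]] := centered_crossP (hcross A oA).
    have := le_trans (distortion_arms_ge hP arms) qe_le.
    by rewrite lee_fin leNgt err24.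
  rewrite At in qe_le *; have [t2|t2] := leP t 2^-1.
    have tle : 0 <= t <= 2^-1 by rewrite t0.
    congr saltire; apply: (saltire_error_eq crit) => //; first by rewrite s0.
    by move: qe_le; rewrite (distortion_saltire hP tle) lee_fin.
  have := le_trans (distortion_saltire_ge hP (ltW t2)) qe_le.
  by rewrite lee_fin leNgt err12.
(* The argument is 4 because existence is stated for [n.+1] points. *)
have [A oA] := exists_optimal_means 4 hP.
have AE := opt A oA; split.
  exists A; split=> //; first by move=> B /opt ->.
  move=> e u v; rewrite AE.
  exists Defs.center, (corner s s), (corner (- s) s), (corner (- s) (- s)), (corner s (- s)).
  split=> //; rewrite /close_coords /= /e /u /v.
  have near_half : `|2^-1 - 1 / 2 : R| <= 1 / 10 ^+ 6.
    by rewrite div1r subrr normr0 divr_ge0// exprn_ge0.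
  by [].
have [_ <-] := oA; rewrite AE (distortion_saltire hP sle).
by rewrite -EFinB abse_EFin lte_fin.
Qed.
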